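(* Let $\mathbb{D}$ be a discrete valuation ring with uniformizer $z$, let $R\subset\mathbb{D}$ be a complete set of coset representatives of $\mathbb{D}$ over $z\mathbb{D}$ with $0\in R$, and consider a causal $\mathbb{D}$-linear network code on a network with $\omega$ source channels. Let $v$ be a node, let $\delta\ge0$ be an integer, and write $[\mathbf{f}_e]_{e\in In(v)}=\sum_{j\ge0}z^jF_j$ with the $F_j$ matrices over $R$. Then the code is decodable at $v$ with delay $\delta$ if and only if both of the following hold: (i) the matrix $\sum_{j=0}^\delta z^jF_j$ is of full rank $\omega$; and (ii) $\delta$ is no smaller than the valuation of $\Delta_{\delta,\omega}/\Delta_{\delta,\omega-1}$, where $\Delta_{\delta,t}$ denotes the greatest common divisor of the determinants of all $t\times t$ submatrices of $\sum_{j=0}^\delta z^jF_j$.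
   Context: A discrete valuation ring (DVR) is a local principal ideal domain that is not a field; its uniformizer $z$ generates the unique maximal ideal, and every nonzero element is a unit times a power $z^k$, with $k$ its valuation. Network: a finite directed multigraph (cycles allowed) whose edges are called channels, with a distinguished source node having exactly $\omega\ge 1$ outgoing channels (the source channels). $In(v)$ is the set of incoming channels of a node $v$. An adjacent pair $(d,e)$ consists of a channel $d$ ending at the node from which the channel $e$ starts. A $\mathbb{D}$-linear network code ($\mathbb{D}$-LNC) assigns a coding coefficient $k_{d,e}\in\mathbb{D}$ to every adjacent pair $(d,e)$. It is causal if around every cycle of the network there is at least one adjacent pair $(d,e)$ with $k_{d,e}$ divisible by $z$. Causality guarantees a unique assignment of coding vectors $\mathbf{f}_e\in\mathbb{D}^\omega$ (column vectors) to the channels $e$ such that the coding vectors of the $\omega$ source channels form the natural basis of $\mathbb{D}^\omega$ and $\mathbf{f}_e=\sum_{d\in In(v)}k_{d,e}\mathbf{f}_d$ for every outgoing channel $e$ of every non-source node $v$. $[\mathbf{f}_e]_{e\in In(v)}$ denotes the $\omega\times|In(v)|$ matrix with columns $\mathbf{f}_e$, $e\in In(v)$. The code is decodable at $v$ with delay $\delta\ge 0$ if there is an $|In(v)|\times\omega$ matrix $\mathbf{A}$ over $\mathbb{D}$ with $[\mathbf{f}_e]_{e\in In(v)}\cdot\mathbf{A}=z^\delta\mathbf{I}$, where $\mathbf{I}$ is the $\omega\times\omega$ identity matrix. Power series expression: every $x\in\mathbb{D}$ is uniquely of the form $\sum_{t\ge0}a_tz^t$ with $a_t\in R$, meaning $x\equiv\sum_{t=0}^{k-1}a_tz^t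 \pmod{z^k}$ for all $k\ge 0$. Applied entrywise, every matrix $\mathbf{M}$ over $\mathbb{D}$ is uniquely $\sum_{j\ge0}z^jM_j$ with each $M_j$ a matrix over $R$. Rank is over $\mathbb{D}$ (equivalently over its fraction field). Greatest common divisors are up to unit factors. Convention: $\Delta_{\delta,0}=1$ (relevant when $\omega=1$). Condition (ii) is considered when (i) holds, so that $\Delta_{\delta,\omega}$ and $\Delta_{\delta,\omega-1}$ are nonzero. *)

(* Defs.v *)
From mathcomp Require Import all_boot all_order all_algebra.

Set Implicit Arguments.
Unset Strict Implicit.
Unset Printing Implicit Defensive.

Import GRing.Theory.
Local Open Scope ring_scope.

Section DiscreteValuationRing.
Variable D : idomainType.

Definition divides (a b : D) : Prop := exists c, b = c * a.

Definition is_ideal (I : D -> Prop) : Prop :=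
  [/\ I 0, forall x y, I x -> I y -> I (x + y) & forall a x, I x -> I (a * x)].

Definition is_maximal_ideal (I : D -> Prop) : Prop :=
  [/\ is_ideal I, ~ I 1 &
      forall J, is_ideal J -> ~ J 1 -> (forall x, I x -> J x) ->
        forall x, J x -> I x].

Definition is_pid : Prop :=
  forall I, is_ideal I -> exists a, forall x, I x <-> divides a x.

Definition is_local : Prop :=
  exists2 m, is_maximal_ideal m &
    forall I, is_maximal_ideal I -> forall x, I x <-> m x.

Definition is_dvr : Prop := [/\ is_local, is_pid & ~ GRing.field_axiom D].

Definition is_uniformizer (z : D) : Prop := is_maximal_ideal (divides z).

Definition is_complete_residue_system (z : D) (R : D -> Prop) : Prop :=
  forall x, exists! r, R r /\ divides z (x - r).

(* D need not be complete, so x = \sum_(t >= 0) a_t z^t means that x is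
   congruent to each partial sum modulo the corresponding power of z. *)
Definition is_power_series (z : D) (R : D -> Prop) (a : nat -> D) (x : D) :
    Prop :=
  (forall t, R (a t)) /\
  (forall k, divides (z ^+ k) (x - \sum_(t < k) a t * z ^+ t)).

Definition is_power_series_mx (z : D) (R : D -> Prop) m n
    (F : nat -> 'M[D]_(m, n)) (M : 'M[D]_(m, n)) : Prop :=
  forall i j, is_power_series z R (fun t => F t i j) (M i j).

Definition has_valuation (z : D) (x : {fraction D}) (k : int) : Prop :=
  exists2 u : D, u \is a GRing.unit &
    x = FracField.tofrac u * FracField.tofrac z ^ k.

Definition is_gcd (S : D -> Prop) (g : D) : Prop :=
  (forall x, S x -> divides g x) /\
  (forall d, (forall x, S x -> divides d x) -> divides d g).

Definition mx_rank_frac m n (M : 'M[D]_(m, n)) : nat :=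
  \rank (map_mx (@FracField.tofrac D) M).

(* For t = 0 the only minor is the empty determinant 1, so that the gcd of the
   minors of order 0 is a unit. *)
Definition is_minor m n (M : 'M[D]_(m, n)) (t : nat) (x : D) : Prop :=
  exists (f : 'I_t -> 'I_m) (g : 'I_t -> 'I_n),
    [/\ forall i j : 'I_t, (i < j)%N -> (f i < f j)%N,
        forall i j : 'I_t, (i < j)%N -> (g i < g j)%N &
        x = \det (mxsub f g M)].

End DiscreteValuationRing.

Record network := Network {
  node : finType;
  channel : finType;
  tail : channel -> node;
  head : channel -> node;
  source : node
}.

Definition in_channels (N : network) (v : node N) : {set channel N} :=
  [set e | head e == v].

Definition out_channels (N : network) (v : node N) : {set channel N} :=
  [set e | tail e == v].

Definition adjacent (N : network) : rel (channel N) :=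
  [rel d e | head d == tail e].

Section LinearNetworkCode.
Variables (D : idomainType) (N : network).

(* Only the values k d e at adjacent pairs (d, e) are ever used. *)
Definition lnc : Type := channel N -> channel N -> D.

(* A cycle is a nonempty closed trail of distinct channels; it may pass
   several times through a node, and a self-loop is a cycle of length one. *)
Definition is_causal (z : D) (k : lnc) : Prop :=
  forall c : seq (channel N), c != [::] -> ucycle (@adjacent N) c ->
    exists2 d, d \in c & divides z (k d (next c d)).

Definition is_coding_vectors (omega : nat) (k : lnc)
    (f : channel N -> 'cV[D]_omega) : Prop :=
  perm_eq [seq f e | e in out_channels (source N)]
          [seq delta_mx i 0 | i : 'I_omega] /\
  (forall v, v != source N -> forall e, e \in out_channels v ->
     f e = \sum_(d in in_channels v) k d e *: f d).

Definition received_mx (omega : nat) (f : channel N -> 'cV[D]_omega)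
    (v : node N) : 'M[D]_(omega, #|in_channels v|) :=
  \matrix_(i, j) f (enum_val j) i 0.

Definition is_decodable (omega : nat) (z : D) (f : channel N -> 'cV[D]_omega)
    (v : node N) (delta : nat) : Prop :=
  exists A : 'M[D]_(#|in_channels v|, omega),
    received_mx f v *m A = z ^+ delta *: 1%:M.

End LinearNetworkCode.

Definition truncation (D : idomainType) m n (z : D) (F : nat -> 'M[D]_(m, n))
    (delta : nat) : 'M[D]_(m, n) :=
  \sum_(j < delta.+1) z ^+ j *: F j.

(* Main.v *)
(* Modulo z ^+ delta.+1 the received matrix M equals its truncation T, and if
   M A = z ^+ delta * I then T A = z ^+ delta * (I - z X) with I - z X
   invertible; so M may be replaced by T. If T B = z ^+ delta * I, bordering a
   t-minor of T by a column z ^+ delta * e_i, itself a combination of columns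
   of T, shows that Delta_(t+1) divides z ^+ delta * Delta_t. Conversely, some
   omega-minor divides all the others, because divisibility is total in a DVR.
   The adjugate of its submatrix is divisible by Delta_(omega-1), and this
   gives a right inverse of T up to Delta_omega / Delta_(omega-1). *)
Require Import Defs.
From mathcomp Require Import all_boot all_order all_algebra all_fingroup.
From Stdlib Require Import Classical ClassicalEpsilon.
Import Order.TTheory GRing.Theory Num.Theory.
Local Open Scope ring_scope.

(** * Divisibility and principal ideals in an integral domain *)

Section Divides.
Set Implicit Arguments.
Unset Strict Implicit.
Variable D : idomainType.
Implicit Types a b c u x : D.

Lemma divides_ideal a : is_ideal (divides a).
Proof.
split; first by exists 0; rewrite mul0r.
- by move=> x y [c ->] [d ->]; exists (c + d); rewrite mulrDl.
- by move=> b x [c ->]; exists (b * c); rewrite mulrA.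
Qed.

Lemma divides_refl a : divides a a.
Proof. by exists 1; rewrite mul1r. Qed.

Lemma divides_trans b a c : divides a b -> divides b c -> divides a c.
Proof. by move=> [x ->] [y ->]; exists (y * x); rewrite mulrA. Qed.

Lemma divides_mull a b c : divides a c -> divides a (b * c).
Proof. by case: (divides_ideal a) => _ _; apply. Qed.

Lemma divides_sum a (I : finType) (F : I -> D) :
  (forall i, divides a (F i)) -> divides a (\sum_i F i).
Proof.
have [a0 aD _] := divides_ideal a => aF.
exact: big_ind.
Qed.

Lemma divides1 u : divides u 1 <-> u \is a GRing.unit.
Proof.
split=> [[c c1]|uU]; last by exists u^-1; rewrite mulVr.
by apply/unitrPr; exists c; rewrite mulrC.
Qed.

(* The union of the principal ideals generated by the [a n] is principal,
   and its generator is a multiple of some [a n]. *)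
Lemma pid_no_strict_divisor_chain (a : nat -> D) :
  is_pid D -> (forall n, divides (a n.+1) (a n)) ->
  exists n, divides (a n) (a n.+1).
Proof.
move=> pid chain.
have chain_le m n : (m <= n)%N -> divides (a n) (a m).
  elim: n => [|n IHn]; first by rewrite leqn0 => /eqP->; apply: divides_refl.
  rewrite leq_eqVlt => /orP[/eqP->|]; first exact: divides_refl.
  by rewrite ltnS => /IHn; apply: divides_trans.
have [|g gP] := pid (fun x => exists n, divides (a n) x).
  split; first by exists 0, 0; rewrite mul0r.
  - move=> x y [m amx] [n any]; exists (maxn m n).
    have [_ + _] := divides_ideal (a (maxn m n)); apply.
    + exact: divides_trans (chain_le _ _ (leq_maxl _ _)) amx.
    + exact: divides_trans (chain_le _ _ (leq_maxr _ _)) any.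
  - by move=> b x [n anx]; exists n; apply: divides_mull.
have [n ang] : exists n, divides (a n) g by apply/gP; apply: divides_refl.
exists n; apply: divides_trans ang _; apply/gP.
by exists n.+1; apply: divides_refl.
Qed.

End Divides.

(** * Units, powers of the uniformizer and valuations in a DVR *)

Section Valuation.
Set Implicit Arguments.
Unset Strict Implicit.
Variables (D : idomainType) (z : D).
Hypotheses (D_dvr : is_dvr D) (z_unif : is_uniformizer z).

Lemma uniformizer_not_divides_unit (u : D) :
  u \is a GRing.unit -> ~ divides z u.
Proof.
move=> /divides1 u1 zu; case: z_unif => _ + _; apply.
exact: divides_trans zu u1.
Qed.

(** If z = 0, the zero ideal is maximal; a nonzero nonunit would generate a larger proper ideal, so
    D would be a field. *)
Lemma uniformizer_neq0 : z != 0.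
Proof.
apply/eqP => z0; case: D_dvr => _ _; apply => x x_neq0.
apply/negPn/negP => xNU; case: z_unif => _ _ /(_ (divides x)) zmax.
have [||y [c ->]||c cx] := zmax _ _ _ x.
- exact: divides_ideal.
- by move/divides1; apply/negP.
- by rewrite z0 mulr0; exists 0; rewrite mul0r.
- exact: divides_refl.
- by move: x_neq0; rewrite cx z0 mulr0 eqxx.
Qed.

(* A nonunit outside (z) lies in no maximal ideal, which would yield an
   infinite chain of strict divisors. *)
Lemma nonunit_divides_uniformizer (w : D) :
  w \isn't a GRing.unit -> divides z w.
Proof.
case: D_dvr => -[m _ m_uniq] pid _ wNU; apply: NNPP => zNw.
pose bad x := x \isn't a GRing.unit /\ ~ divides z x.
have step x : bad x -> exists y, [/\ bad y, divides y x & ~ divides x y].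
  move=> [xNU zNx]; apply: NNPP => no_y.
  have xmax : is_maximal_ideal (divides x).
    split; [exact: divides_ideal | by move/divides1; apply/negP |].
    move=> J Jid JN1 xJ t Jt; apply: NNPP => xNt.
    have [y yP] := pid J Jid; apply: no_y; exists y.
    have yx : divides y x by apply/yP/xJ; apply: divides_refl.
    split=> //; last by move=> xy; apply: xNt; apply: divides_trans xy _; apply/yP.
    split; first by apply/negP => /divides1 y1; apply/JN1/yP.
    by move=> zy; apply: zNx; apply: divides_trans zy yx.
  by apply/zNx/(m_uniq _ z_unif)/(m_uniq _ xmax); apply: divides_refl.
(* Existence is made unconditional, with dummy value 0, so that a total choice function [next] can
   be iterated. *)
have stepW x : exists y, bad x -> [/\ bad y, divides y x & ~ divides x y].
  have [/step[y yP]|xN] := classic (bad x); first by exists y.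
  by exists 0 => /xN.
pose next x := proj1_sig (constructive_indefinite_description _ (stepW x)).
have nextP x : bad x -> [/\ bad (next x), divides (next x) x & ~ divides x (next x)].
  exact: proj2_sig (constructive_indefinite_description _ (stepW x)).
pose a n := iter n next w.
have bad_a n : bad (a n) by elim: n => [|n /nextP[]].
have [n|n] := pid_no_strict_divisor_chain (a := a) pid; first by case: (nextP _ (bad_a n)).
by case: (nextP _ (bad_a n)).
Qed.

Lemma divisor_of_uniformizer_pow (k : nat) (w y : D) :
  w * y = z ^+ k -> exists2 u, u \is a GRing.unit & exists l, w = u * z ^+ l.
Proof.
elim: k w => [|k IHk] w wy.
  exists w; last by exists 0%N; rewrite mulr1.
  by apply/unitrPr; exists y.
have [wU|/nonunit_divides_uniformizer[w' w'E]] := boolP (w \is a GRing.unit).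
  by exists w => //; exists 0%N; rewrite mulr1.
have [|u uU [l w'l]] := IHk w'.
  by apply: (mulIf uniformizer_neq0); rewrite mulrAC -w'E wy exprSr.
by exists u => //; exists l.+1; rewrite w'E w'l -mulrA exprSr.
Qed.

(* The ideal of all x such that c divides some x * z ^+ k has a generator g
   that z does not divide, so that g is a unit. *)
Lemma unit_mul_uniformizer_pow (c : D) :
  c != 0 -> exists2 u, u \is a GRing.unit & exists k, c = u * z ^+ k.
Proof.
move=> c_neq0; have [_ pid _] := D_dvr.
have [|g gP] := pid (fun x => exists k, divides c (x * z ^+ k)).
  split; first by exists 0%N, 0; rewrite !mul0r.
  - move=> x y [k cx] [l cy]; exists (k + l)%N.
    have [_ + _] := divides_ideal c; rewrite mulrDl; apply.
    + by rewrite addnC exprD mulrCA; apply: divides_mull.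
    + by rewrite exprD mulrCA; apply: divides_mull.
  - by move=> b x [k cx]; exists k; rewrite -mulrA; apply: divides_mull.
have [w cE] : divides g c by apply/gP; exists 0%N; rewrite mulr1; apply: divides_refl.
have g_neq0 : g != 0 by apply: contraNneq c_neq0 => g0; rewrite cE g0 mulr0.
have [k [y gzk]] : exists k, divides c (g * z ^+ k) by apply/gP; apply: divides_refl.
have [u uU [l wE]] : exists2 u, u \is a GRing.unit & exists l, w = u * z ^+ l.
  apply: (@divisor_of_uniformizer_pow k w y); apply: (mulfI g_neq0).
  by rewrite gzk cE mulrA mulrC [g * w]mulrC.
(* If g = g' z, then g' z^(k+1) = g z^k puts g' in the ideal, so g divides g' and z would be a
   unit. *)
have gU : g \is a GRing.unit.
  apply/negPn/negP => /nonunit_divides_uniformizer[g' g'E].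
  have [h hE] : divides g g'.
    apply/gP; exists k.+1; rewrite exprS mulrA -g'E gzk.
    exact: divides_mull (divides_refl _).
  apply: (uniformizer_not_divides_unit (unitr1 D)); exists h.
  by apply: (mulfI g_neq0); rewrite mulr1 {1}g'E hE mulrA [g * h]mulrC.
exists (g * u); first by rewrite unitrM gU.
by exists l; rewrite cE wE mulrC mulrA.
Qed.

Lemma divides_total (a b : D) : divides a b \/ divides b a.
Proof.
have [->|a_neq0] := eqVneq a 0; first by right; exists 0; rewrite mul0r.
have [->|b_neq0] := eqVneq b 0; first by left; exists 0; rewrite mul0r.
have [u uU [k ->]] := unit_mul_uniformizer_pow a_neq0.
have [v vU [l ->]] := unit_mul_uniformizer_pow b_neq0.
have pow_dvd x y i j : x \is a GRing.unit -> (i <= j)%N ->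
    divides (x * z ^+ i) (y * z ^+ j).
  move=> xU ij; exists (y * x^-1 * z ^+ (j - i)).
  by rewrite [x * _]mulrC mulrA -[_ * z ^+ (j - i) * _]mulrA -exprD subnK // mulrAC divrK.
by have [/pow_dvd|/ltnW/pow_dvd] := leqP k l; [left|right]; auto.
Qed.

Lemma divides_minimum (s : seq D) :
  s != [::] -> exists2 x, x \in s & forall y, y \in s -> divides x y.
Proof.
case: s => // a s _; elim: s a => [|b s IHs] a.
  by exists a; rewrite ?mem_head // => y; rewrite inE => /eqP->; apply: divides_refl.
have [x xs xmin] := IHs b; have [ax|xa] := divides_total a x.
  exists a; first exact: mem_head.
  move=> y; rewrite inE => /predU1P[->|/xmin]; first exact: divides_refl.
  exact: divides_trans.
by exists x => [|y]; rewrite inE ?xs ?orbT // => /predU1P[->|/xmin].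
Qed.

(** Moves condition (ii) from the fraction field into D: if a / b = u z^n, then z^delta b / a = u^-1
    z^(delta - n), which lies in D when n <= delta. *)
Lemma has_valuation_div_le (a b : D) (delta : nat) : a != 0 -> b != 0 ->
  (exists2 n : int, has_valuation z (FracField.tofrac a / FracField.tofrac b) n
                  & n <= delta%:Z)
  <-> divides a (z ^+ delta * b).
Proof.
move=> a_neq0 b_neq0.
have tf_neq0 (x : D) : x != 0 -> FracField.tofrac x != 0 by rewrite tofrac_eq0.
have z_neq0 := uniformizer_neq0; split.
- case=> n [u uU abE]; rewrite -subr_ge0 => n_le.
  exists (u^-1 * z ^+ `|delta%:Z - n|); apply: (mulrI uU); rewrite !mulrA mulrV // mul1r.
  apply/eqP; rewrite -tofrac_eq; apply/eqP; rewrite !tofracM !tofracXn !exprnP gez0_abs //.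
  rewrite -[FracField.tofrac a](divfK (tf_neq0 _ b_neq0)) abE !mulrA; congr (_ * _).
  by rewrite -mulrA mulrCA -expfzDr ?tf_neq0 // subrK.
- case=> c zbE.
  have [|u uU [k cE]] := @unit_mul_uniformizer_pow c.
    apply: contraTneq (mulf_neq0 (expf_neq0 delta z_neq0) b_neq0) => c0.
    by rewrite zbE c0 mul0r eqxx.
  exists (delta%:Z - k%:Z); last by rewrite gerBl.
  exists u^-1; rewrite ?unitrV //.
  apply: (mulIf (tf_neq0 _ b_neq0)); rewrite divfK ?tf_neq0 //.
  rewrite expfzDr ?tf_neq0 // -invr_expz -!exprnP -!tofracXn.
  have zk_neq0 := tf_neq0 _ (expf_neq0 k z_neq0).
  apply: (mulIf zk_neq0); rewrite [RHS]mulrAC -[X in _ = X * _]mulrA divfK //.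
  rewrite -!tofracM; congr FracField.tofrac.
  apply: (mulrI uU); rewrite !mulrA mulrV // mul1r zbE cE.
  by rewrite mulrAC.
Qed.
End Valuation.

(** * Right inverses under perturbation modulo a power of z *)

Section Perturbation.
Variables (D : idomainType) (z : D).
Hypotheses (D_dvr : is_dvr D) (z_unif : is_uniformizer z).
Set Implicit Arguments.
Unset Strict Implicit.

(* The determinant of A + 'X *: B is a polynomial with constant term \det A. *)
Lemma det_add_scale n (A B : 'M[D]_n) : divides z (\det (A + z *: B) - \det A).
Proof.
pose p := \det (map_mx polyC A + 'X *: map_mx polyC B).
have evalP x : p.[x] = \det (A + x *: B).
  rewrite -[p.[x]]/(horner_eval x p) /p -det_map_mx; congr (\det _).
  by apply/matrixP => i j; rewrite !mxE /= /horner_eval !hornerE.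
have /factor_theorem[q pE] : root (p - p.[0]%:P) 0 by rewrite /root !hornerE subrr.
exists q.[z]; have := congr1 (fun q => q.[z]) pE.
by rewrite !hornerE !evalP scale0r addr0 subr0.
Qed.

(** The determinant is 1 modulo z, whereas a nonunit would be divisible by z. *)
Lemma one_sub_scale_unitmx n (X : 'M[D]_n) : 1%:M - z *: X \in unitmx.
Proof.
rewrite unitmxE; apply/negPn/negP.
move=> /(nonunit_divides_uniformizer D_dvr z_unif) zdet.
have [c cE] := det_add_scale 1%:M (- X); move: cE; rewrite scalerN det1 => cE.
apply: (uniformizer_not_divides_unit z_unif (unitr1 D)).
case: zdet => d dE; exists (d - c); rewrite mulrBl -dE -cE.
by rewrite opprB addrC subrK.
Qed.

Lemma right_inverse_perturbation m n (M T E : 'M[D]_(m, n)) delta :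
  M = T + z ^+ delta.+1 *: E ->
  (exists A : 'M_(n, m), M *m A = z ^+ delta *: 1%:M) ->
  exists B : 'M_(n, m), T *m B = z ^+ delta *: 1%:M.
Proof.
move=> ME [A MA]; have U := one_sub_scale_unitmx (E *m A).
exists (A *m invmx (1%:M - z *: (E *m A))).
have TA : T *m A = z ^+ delta *: (1%:M - z *: (E *m A)).
  by rewrite scalerBr -MA ME mulmxDl -scalemxAl scalerA -exprSr addrK.
by rewrite mulmxA TA -scalemxAl mulmxV.
Qed.

End Perturbation.

(** * Minors with arbitrary index maps, and bordered minors *)

Section Minors.
Variables (D : idomainType) (m n : nat) (M : 'M[D]_(m, n)).
Set Implicit Arguments.
Unset Strict Implicit.

(** The permutation sorts the indices by their values under f; injectivity makes the sorted values
    strictly increasing. *)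
Lemma injective_perm_increasing t p (f : 'I_t -> 'I_p) : injective f ->
  exists s : 'S_t, forall i j : 'I_t, (i < j)%N -> (f (s i) < f (s j))%N.
Proof.
move=> f_inj.
pose r := relpre (fun i => f i : nat) leq.
have : perm_eq (sort r (ord_tuple t)) (ord_tuple t) by rewrite perm_sort.
move=> /tuple_permP[s sortE]; exists s => i j ij.
pose l := [seq f i : nat | i <- sort r (ord_tuple t)].
have l_sorted : sorted ltn l.
  rewrite ltn_sorted_uniq_leq map_inj_uniq ?sort_uniq ?enum_uniq /=; last first.
    by move=> x y /val_inj/f_inj.
  rewrite /l sorted_map; apply: sort_sorted => x y; exact: leq_total.
have size_l : size l = t by rewrite size_map size_sort size_tuple.
have nth_l (x : 'I_t) : nth 0%N l x = f (s x).
  rewrite /l (nth_map x) ?size_sort ?size_tuple // sortE -tnth_nth tnth_mktuple.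
  by rewrite tnth_ord_tuple.
rewrite -!nth_l; apply: (sorted_ltn_nth ltn_trans) => //; rewrite inE size_l //.
Qed.

(** [is_minor] admits only increasing index maps. A map with a repetition gives determinant 0, and
    injective maps give an increasing minor up to sign. *)
Lemma divides_det_mxsub d t (f : 'I_t -> 'I_m) (g : 'I_t -> 'I_n) :
  (forall x, is_minor M t x -> divides d x) -> divides d (\det (mxsub f g M)).
Proof.
move=> dM.
have [/injectiveP f_inj|/injectivePn[i [j ij fij]]] := boolP (injectiveb f); last first.
  rewrite (determinant_alternate ij) => [|k]; first by exists 0; rewrite mul0r.
  by rewrite !mxE fij.
have [/injectiveP g_inj|/injectivePn[i [j ij gij]]] := boolP (injectiveb g); last first.
  rewrite -det_tr (determinant_alternate ij) => [|k]; first by exists 0; rewrite mul0r.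
  by rewrite !mxE gij.
have [s s_incr] := injective_perm_increasing f_inj.
have [u u_incr] := injective_perm_increasing g_inj.
have -> : mxsub f g M = row_perm s^-1 (col_perm u^-1 (mxsub (f \o s) (g \o u) M)).
  by apply/matrixP => i j; rewrite !mxE /= !permKV.
rewrite row_permE col_permE !det_mulmx !det_perm.
apply: divides_mull; rewrite mulrC; apply: divides_mull; apply: dM.
by exists (f \o s), (g \o u).
Qed.

(* Both sides are Laplace expansions, along the first column, of the minor
   obtained by bordering [mxsub f g M] with row i and with column
   c * e_i = M *m col i B. *)
Lemma divides_bordered_minor (B : 'M[D]_(n, m)) (c d : D) t
    (f : 'I_t -> 'I_m) (g : 'I_t -> 'I_n) :
  (t < m)%N -> M *m B = c *: 1%:M ->
  (forall x, is_minor M t.+1 x -> divides d x) ->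
  divides d (c * \det (mxsub f g M)).
Proof.
move=> tm MB dM.
have [i iNf] : exists i, i \notin codom f.
  apply/existsP; rewrite -negb_forall; apply/negP => /forallP all_f.
  have : (#|'I_m| <= #|codom f|)%N by apply/subset_leq_card/subsetP => x _; apply: all_f.
  by rewrite card_ord leqNgt (leq_ltn_trans (leq_image_card _ _)) // card_ord.
pose f' (a : 'I_t.+1) := oapp f i (unlift ord0 a).
pose g' j (a : 'I_t.+1) := oapp g j (unlift ord0 a).
(* The cofactors along the bordering column do not depend on which column j is used. *)
pose K (a : 'I_t.+1) := (-1) ^+ (a + (ord0 : 'I_t.+1))%N * \det (row' a (mxsub f' g M)).
have f'0 : f' ord0 = i by rewrite /f' unlift_none.
have f'S a : f' (lift ord0 a) = f a by rewrite /f' liftK.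
have detC j : \det (mxsub f' (g' j) M) = \sum_a M (f' a) j * K a.
  rewrite (expand_det_col _ ord0); apply: eq_bigr => a _; rewrite mxE {1}/g' unlift_none.
  congr (_ * (_ * \det _)); apply/matrixP => x y; rewrite !mxE /g' liftK //.
have -> : c * \det (mxsub f g M) = \sum_j B j i * \det (mxsub f' (g' j) M).
  under eq_bigr => j _ do rewrite detC mulr_sumr.
  (* After the exchange, the inner sum is the entry (f' a, i) of c I, nonzero at most for a = 0
     because f misses i. *)
  rewrite exchange_big /= (bigD1 ord0) //= [X in _ + X]big1 ?addr0 => [|a a_neq0].
    under eq_bigr => j _ do rewrite mulrA [B j i * _]mulrC.
    rewrite -mulr_suml; have := congr1 (fun X : 'M_m => X (f' ord0) i) MB.
    rewrite !mxE => ->; rewrite f'0 eqxx mulr1 /K expr0 mul1r; congr (_ * \det _).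
    by apply/matrixP => x y; rewrite !mxE f'S.
  under eq_bigr => j _ do rewrite mulrA [B j i * _]mulrC.
  rewrite -mulr_suml; have := congr1 (fun X : 'M_m => X (f' a) i) MB.
  rewrite !mxE => ->; case: (unliftP ord0 a) a_neq0 => [b ->|->] //.
  move=> _; rewrite f'S; case: eqP => [fbi|]; last by rewrite mulr0 mul0r.
  by case/negP: iNf; rewrite -fbi codom_f.
by apply: divides_sum => j; apply: divides_mull; apply: divides_det_mxsub.
Qed.
End Minors.

(** * Truncation of the power series expansion *)

Lemma power_series_truncation (D : idomainType) (z : D) (R : D -> Prop) m n
    (F : nat -> 'M[D]_(m, n)) (M : 'M[D]_(m, n)) delta :
  is_power_series_mx z R F M ->
  exists E, M = truncation z F delta + z ^+ delta.+1 *: E.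
Proof.
move=> FM.
have /fin_all_exists[E EP] (i : 'I_m) : exists r : 'rV_n,
    row i M = row i (truncation z F delta) + z ^+ delta.+1 *: r.
  have /fin_all_exists[r rP] (j : 'I_n) : exists y,
      M i j - truncation z F delta i j = y * z ^+ delta.+1.
    have [_ /(_ delta.+1)] := FM i j; rewrite /truncation summxE.
    by under [X in _ -> exists y, _ - X = _]eq_bigr => t _ do rewrite mxE mulrC.
  exists (\row_j r j); apply/rowP => j; rewrite 4!mxE mxE [_ * r j]mulrC -rP.
  by rewrite addrC subrK.
exists (\matrix_i E i); apply/row_matrixP => i.
by rewrite EP linearD linearZ /= rowK.
Qed.

(** * Right inverses and the gcds of minors *)

Section RightInverse.
Variables (D : idomainType) (z : D).
Hypotheses (D_dvr : is_dvr D) (z_unif : is_uniformizer z).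
Variables (m n : nat) (T : 'M[D]_(m.+1, n)) (Delta : nat -> D) (delta : nat).
Hypothesis Delta_gcd : forall t, is_gcd (is_minor T t) (Delta t).
Set Implicit Arguments.
Unset Strict Implicit.

Lemma det_mxsub_gcd t (f : 'I_t -> 'I_m.+1) (g : 'I_t -> 'I_n) :
  divides (Delta t) (\det (mxsub f g T)).
Proof. by apply: divides_det_mxsub; case: (Delta_gcd t). Qed.

Section Necessity.
Variable B : 'M[D]_(n, m.+1).
Hypothesis TB : T *m B = z ^+ delta *: 1%:M.

(** Bordering handles each t-minor; passing to their gcd requires cancelling z^delta. By totality,
    either Delta_(t+1) divides z^delta, or it is y z^delta and y divides every t-minor. *)
Lemma gcd_minors_succ t : (t < m.+1)%N ->
  divides (Delta t.+1) (z ^+ delta * Delta t).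
Proof.
move=> tm; have zd_neq0 := expf_neq0 delta (uniformizer_neq0 D_dvr z_unif).
have [zd|[y yE]] := divides_total D_dvr z_unif (Delta t.+1) (z ^+ delta).
  by rewrite mulrC; apply: divides_mull.
have [_ gcd_max] := Delta_gcd t; have [|c ->] := gcd_max y.
  move=> _ [f [g [_ _ ->]]].
  have [c cE] := divides_bordered_minor f g tm TB (Delta_gcd t.+1).1.
  by exists c; apply: (mulfI zd_neq0); rewrite cE yE mulrA mulrC.
by exists c; rewrite yE mulrCA [y * _]mulrC.
Qed.

(** Delta_0 divides the empty determinant 1, and each Delta_(t+1) divides the nonzero z^delta
    Delta_t. *)
Lemma gcd_minors_neq0 t : (t <= m.+1)%N -> Delta t != 0.
Proof.
elim: t => [_|t IHt tm].
  have [c] := det_mxsub_gcd (ffun0 (card_ord 0)) (ffun0 (card_ord 0)).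
  by rewrite det_mx00 => /eqP; apply: contraTneq => ->; rewrite mulr0 oner_eq0.
have [c] := gcd_minors_succ tm; move/eqP; apply: contraTneq => ->.
rewrite mulr0 mulf_neq0 ?IHt ?(ltnW tm) //.
by rewrite expf_neq0 ?(uniformizer_neq0 D_dvr).
Qed.

Lemma mx_rank_frac_right_inverse : mx_rank_frac T = m.+1.
Proof.
have zd_neq0 := expf_neq0 delta (uniformizer_neq0 D_dvr z_unif).
apply/eqP; rewrite eqn_leq rank_leq_row /=.
have := mxrankM_maxl (map_mx (@FracField.tofrac D) T) (map_mx (@FracField.tofrac D) B).
rewrite -map_mxM TB scalemx1 map_scalar_mx mxrank_unit //.
by rewrite unitmxE det_scalar unitfE expf_neq0 // tofrac_eq0.
Qed.

End Necessity.

Lemma adjugate_right_inverse :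
  Delta m.+1 != 0 -> Delta m != 0 -> divides (Delta m.+1) (z ^+ delta * Delta m) ->
  exists B : 'M_(n, m.+1), T *m B = z ^+ delta *: 1%:M.
Proof.
move=> Dw_neq0 Dm_neq0 [c cE].
pose minor (g : {ffun 'I_m.+1 -> 'I_n}) := \det (colsub g T).
(* The extra 0 keeps the list nonempty when n = 0; as the minimum it would force Delta_(m+1) = 0. *)
have [x xs xmin] := divides_minimum D_dvr z_unif (s := 0 :: codom minor) isT.
have x_dvd : divides x (Delta m.+1).
  have [_ gcd_max] := Delta_gcd m.+1; apply: gcd_max => _ [f [g [_ _ ->]]].
  (* Selecting rows is a left multiplication, so the minor is a multiple of a minor on all rows. *)
  have -> : mxsub f g T = rowsub f 1%:M *m colsub [ffun i => g i] T.
    rewrite mul_rowsub_mx mul1mx; apply/matrixP => i j; rewrite !mxE ffunE //.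
  rewrite det_mulmx; apply: divides_mull; apply: xmin.
  by rewrite inE codom_f orbT.
move: xs; rewrite inE => /predU1P[x0|/codomP[g xE]].
  by case: x_dvd Dw_neq0 => y ->; rewrite x0 mulr0 eqxx.
have [C CE] : exists C : 'M_m.+1, \adj (colsub g T) = Delta m *: C.
  have /fin_all_exists[C CE] (i : 'I_m.+1) : exists r : 'rV_m.+1,
      row i (\adj (colsub g T)) = Delta m *: r.
    have /fin_all_exists[r rE] (j : 'I_m.+1) : exists y,
        \adj (colsub g T) i j = y * Delta m.
      rewrite mxE /cofactor; apply: divides_mull.
      have -> : row' j (col' i (colsub g T)) = mxsub (lift j) (g \o lift i) T.
        by apply/matrixP => a b; rewrite !mxE.
      exact: det_mxsub_gcd.
    by exists (\row_j r j); apply/rowP => j; rewrite mxE rE !mxE mulrC.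
  exists (\matrix_i C i); apply/row_matrixP => i; rewrite CE linearZ /= rowK //.
have [q qE] := x_dvd.
(* The submatrix times C is (x / Delta_m) I, and c q x = c Delta_(m+1) = z^delta Delta_m. The factor
   [colsub g 1%:M] places the rows of C at the selected columns of T. *)
exists (colsub g 1%:M *m (c * q *: C)).
rewrite mulmxA mulmx_colsub mulmx1 -scalemxAr.
have TC : Delta m *: (colsub g T *m C) = x%:M by rewrite scalemxAr -CE mul_mx_adj xE.
apply/matrixP => i j; apply: (mulfI Dm_neq0).
have := congr1 (fun X : 'M_m.+1 => X i j) TC; rewrite !mxE mulrCA => ->.
by rewrite -[x *+ _]mulr_natr [LHS]mulrA -[c * q * x]mulrA -qE -cE -mulrA mulrCA.
Qed.
End RightInverse.

Theorem corollary8 (D : idomainType) (z : D) (R : D -> Prop)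
    (N : network) (omega : nat) (k : lnc D N)
    (f : channel N -> 'cV[D]_omega) (v : node N) (delta : nat)
    (F : nat -> 'M[D]_(omega, #|in_channels v|)) (Delta : nat -> D)
    (D_dvr : is_dvr D) (z_unif : is_uniformizer z)
    (R_reps : is_complete_residue_system z R) (R0 : R 0)
    (omega_gt0 : (0 < omega)%N)
    (source_out : #|out_channels (source N)| = omega)
    (k_causal : is_causal z k) (f_coding : is_coding_vectors k f)
    (F_expansion : is_power_series_mx z R F (received_mx f v))
    (Delta_gcd : forall t,
       is_gcd (is_minor (truncation z F delta) t) (Delta t)) :
  is_decodable z f v delta <->
  (mx_rank_frac (truncation z F delta) = omega /\
   exists2 n : int,
     has_valuation z (FracField.tofrac (Delta omega) /
                      FracField.tofrac (Delta omega.-1)) n &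
     n <= delta%:Z).
Proof.
have [E ME] := power_series_truncation delta F_expansion.
case: omega omega_gt0 source_out f F f_coding F_expansion Delta_gcd E ME
  => [//|w] _ _ f F _ _ Delta_gcd E ME /=.
set T := truncation z F delta in Delta_gcd ME *.
(* The perturbation lemma serves both directions, with E and with -E. *)
have TE : T = received_mx f v + z ^+ delta.+1 *: (- E).
  by rewrite ME scalerN addrK.
split=> [/(right_inverse_perturbation D_dvr z_unif ME)[B TB]|[_ val_le]].
  split; first exact: (mx_rank_frac_right_inverse D_dvr z_unif TB).
  have D_neq0 := gcd_minors_neq0 D_dvr z_unif Delta_gcd TB.
  apply/(has_valuation_div_le D_dvr z_unif); rewrite ?D_neq0 //.
  exact: (gcd_minors_succ D_dvr z_unif Delta_gcd TB).
apply: (right_inverse_perturbation D_dvr z_unif TE).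
have [n [u uU nE] _] := val_le.
(* A quotient u z^n is nonzero; as division by 0 yields 0, both gcds are nonzero. *)
have : FracField.tofrac (Delta w.+1) / FracField.tofrac (Delta w) != 0.
  have z_neq0 := uniformizer_neq0 D_dvr z_unif.
  have u_neq0 : u != 0 by apply: contraTneq uU => ->; rewrite unitr0.
  by rewrite nE mulf_neq0 ?expfz_neq0 ?tofrac_eq0.
rewrite mulf_eq0 invr_eq0 !tofrac_eq0 negb_or => /andP[Dw_neq0 Dm_neq0].
apply: (adjugate_right_inverse D_dvr z_unif Delta_gcd) => //.
exact/(has_valuation_div_le D_dvr z_unif).
Qed.
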